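(* Let $\mathbb{K}$ be a field. There are, up to isomorphism, exactly ten square free monomial Cremona sets $F=\{f_1,\dots,f_6\}$ of degree $3$ in $\mathbb{K}[x_1,\dots,x_6]$ whose log matrix $A_F$ is of type 1, i.e. $A_F$ does not have a row with five entries equal to $1$ but has a row with only one entry equal to $1$.
   Context: Let $F=\{f_1,\dots,f_n\}$ be a set of $n$ monomials of the same degree $d$ in $\mathbb{K}[x_1,\dots,x_n]$; write $f_j=x_1^{v_{1j}}\cdots x_n^{v_{nj}}$. The log matrix of $F$ is $A_F=(v_{ij})_{n\times n}$, so rows correspond to variables and columns to monomials. $F$ is square free if all $v_{ij}\in\{0,1\}$. $F$ is a Cremona set if the extension $\mathbb{K}[f_1,\dots,f_n]\subset \mathbb{K}[\underline{x}_d]$ becomes an equality on the level of fields of fractions, where $\mathbb{K}[\underline{x}_d]$ is the algebra generated by all monomials of degree $d$ in $x_1,\dots,x_n$ (equivalently, the rational map $\mathbb{P}^{n-1}\dashrightarrow\mathbb{P}^{n-1}$ given by $(f_1:\dots:f_n)$ is birational). Standing assumption (canonical restrictions): for each $j$ there is a $k$ with $x_j\mid f_k$ and there is a $k$ with $x_j\nmid f_k$. Two Cremona sets $F,F'$ are isomorphic if $F'=\sigma(F)$ (as unordered sets) for some $\sigma\in S_n$ acting by permutation of the variables. *)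

(* Defs.v *)
From HB Require Import structures.
From mathcomp Require Import all_boot all_fingroup all_algebra.
From mathcomp.multinomials Require Import mpoly.

Set Implicit Arguments.
Unset Strict Implicit.
Unset Printing Implicit Defensive.

Import GRing.Theory.
Local Open Scope ring_scope.

(* The K-subalgebra of A generated by S. *)
Inductive gen_subalg (K : comNzRingType) (A : algType K) (S : A -> Prop) :
    A -> Prop :=
| gen_subalg_mem a : S a -> gen_subalg S a
| gen_subalg_scalar c : gen_subalg S c%:A
| gen_subalg_add a b :
    gen_subalg S a -> gen_subalg S b -> gen_subalg S (a + b)
| gen_subalg_mul a b :
    gen_subalg S a -> gen_subalg S b -> gen_subalg S (a * b).

(* The field of fractions of a subring B of a domain D, as a subfield of the
   field of fractions of D. *)
Definition frac_of (D : idomainType) (B : D -> Prop) (z : {fraction D}) : Prop :=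
  exists p q : D, [/\ B p, B q, q != 0 & z = tofrac p / tofrac q].

Section Monomials.
Variable n : nat.

(* An ordered list f_1, ..., f_n of monomials in n variables is given by the
   list of its exponent vectors; f_j is 'X_[tnth F j]. *)
Implicit Types F : n.-tuple 'X_{1..n}.

Definition monomials (K : fieldType) F : seq {mpoly K[n]} :=
  [seq 'X_[m] | m : 'X_{1..n} <- F].

Definition log_matrix F : 'M[nat]_n := \matrix_(i, j) tnth F j i.

Definition of_degree (d : nat) F : Prop := forall j, mdeg (tnth F j) = d.

Definition square_free F : Prop :=
  forall i j, log_matrix F i j \in [:: 0%N; 1%N].

(* x_i divides f_j iff the (i, j) entry of the log matrix is nonzero. *)
Definition canonical_restrictions F : Prop :=
  forall i, (exists j, log_matrix F i j != 0%N) /\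
            (exists j, log_matrix F i j = 0%N).

(* K[x_d], generated by all the monomials of degree d. *)
Definition veronese (K : fieldType) (d : nat) : {mpoly K[n]} -> Prop :=
  gen_subalg (fun f => exists2 m : 'X_{1..n}, mdeg m = d & f = 'X_[m]).

(* The monomials are distinct because F stands for a set with n elements. *)
Definition cremona_set (K : fieldType) (d : nat) F : Prop :=
  [/\ uniq F, of_degree d F, canonical_restrictions F &
      forall z : {fraction {mpoly K[n]}},
        frac_of (gen_subalg (fun f => f \in monomials K F)) z <->
        frac_of (@veronese K d) z].

(* Equality of unordered sets without repetition is perm_eq of the lists. *)
Definition isomorphic (K : fieldType) F F' : Prop :=
  exists s : 'S_n,
    perm_eq (monomials K F') [seq msym s f | f <- monomials K F].

End Monomials.

Definition row_ones (n : nat) (A : 'M[nat]_n) (i : 'I_n) : nat :=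
  #|[set j | A i j == 1%N]|.

Definition type1 (A : 'M[nat]_6) : Prop :=
  ~ (exists i, row_ones A i = 5%N) /\ (exists i, row_ones A i = 1%N).

(* Main.v *)
(* A set of n monomials of degree d is Cremona iff |det A_F| = d. Indeed, comparing
   supports in X^m * q = p with p, q in K[F] shows that X^m is a fraction over K[F] iff m is
   an integer combination of the columns of A_F, and the lattice of exponents of degree
   divisible by d has index d. For n = 6, d = 3 and type 1, relabel the variables so that
   the only monomial containing x_5 is x_3 x_4 x_5. The five other monomials are among the
   ten squarefree cubics in x_0, ..., x_4, and the 252 choices are classified by computation
   up to permutations of {0, 1, 2} and of {3, 4}. *)

Require Import Defs.
From mathcomp Require Import all_boot all_order all_fingroup all_algebra.
From mathcomp.multinomials Require Import mpoly.

Set Implicit Arguments.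
Unset Strict Implicit.
Unset Printing Implicit Defensive.

Import Order.TTheory GRing.Theory Num.Theory.
Local Open Scope ring_scope.

(** * Square integer matrices whose columns all sum to [d] *)

Section IntMatrices.
Variable n : nat.
Implicit Types d : int.

(* Columns (d-1) e_0 + e_k: an affine basis, made of nonnegative vectors when d > 0, of the
   integer vectors with coordinate sum d; slice_coord gives the coordinates in it. *)
Definition slice_basis d : 'M[int]_n.+1 :=
  \matrix_(i, k) ((i == k)%:R + (i == 0)%:R * (d - 1)).

Definition slice_coord m (V : 'M[int]_(n.+1, m)) : 'M[int]_(n.+1, m) :=
  \matrix_(i, j) (V i j + (i == 0)%:R * (1 - \sum_k V k j)).

Lemma det_slice_basis d : \det (slice_basis d) = d.
Proof.
rewrite -det_tr det_trig; last first.
  apply/is_trig_mxP => i j lt_ij; rewrite !mxE.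
  have /negbTE-> : j != i by rewrite neq_ltn lt_ij orbT.
  have /negbTE-> : j != 0 by rewrite -lt0n (leq_ltn_trans _ lt_ij).
  by rewrite mul0r addr0.
rewrite big_ord_recl !mxE !eqxx mul1r addrC subrK.
rewrite big1 ?mulr1 // => i _; rewrite !mxE eqxx mul0r addr0 //.
Qed.

(** [slice_basis d] sends a column [c] to [c + (d - 1) (sum of c) e_0]. The correction in row 0
    makes every column of [slice_coord V] sum to 1, so it adds [(d - 1) e_0], which cancels that
    correction. *)
Lemma slice_coordK d m (V : 'M[int]_(n.+1, m)) :
  (forall j, \sum_i V i j = d) -> slice_basis d *m slice_coord V = V.
Proof.
move=> sumV; apply/matrixP => i j; rewrite mxE.
transitivity (\sum_k ((i == k)%:R * slice_coord V k j) +
   (i == 0)%:R * (d - 1) * \sum_k slice_coord V k j).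
  by rewrite mulr_sumr -big_split /=; apply: eq_bigr => k _; rewrite mxE mulrDl.
have -> : \sum_k slice_coord V k j = 1.
  under eq_bigr do rewrite mxE.
  rewrite big_split /= -mulr_suml sumV.
  rewrite (bigD1 ord0) //= big1 ?addr0 ?mul1r 1?addrC ?subrK //.
  by move=> k /negbTE->.
rewrite (bigD1 i) //= eqxx mul1r big1 ?addr0; last first.
  by move=> k /negbTE; rewrite eq_sym => ->; rewrite mul0r.
by rewrite mulr1 mxE sumV -addrA -mulrDr addrA subrK subrr mulr0 addr0.
Qed.

Lemma unitz_absz (x : int) : (x \is a GRing.unit) = (`|x|%N == 1)%N.
Proof. by case: x => [[|[|k]]|[|k]]. Qed.

Variables (d : int) (A : 'M[int]_n.+1).
Hypotheses (d_gt0 : 0 < d) (sumA : forall j, \sum_i A i j = d).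

Lemma det_slice_coord : \det A = d * \det (slice_coord A).
Proof. by rewrite -{1}(slice_coordK sumA) det_mulmx det_slice_basis. Qed.

Lemma absz_det_slice_coord :
  (`|\det A| == `|d|)%N = (slice_coord A \in unitmx).
Proof.
rewrite det_slice_coord abszM unitmxE unitz_absz -{2}[`|d|%N]muln1 eqn_pmul2l //.
by rewrite absz_gt0 gt_eqF.
Qed.

(** The columns of [slice_basis d] are themselves nonnegative of sum [d], so they are integer
    combinations of the columns of [A]. This gives [A *m X = slice_basis d]; taking determinants and
    cancelling [d] makes the determinant of [slice_coord A] a unit. *)
Lemma slice_span_absz_det :
  (forall m : 'cV[int]_n.+1, (forall i, 0 <= m i 0) -> \sum_i m i 0 = d ->
     exists c, A *m c = m) ->
  (`|\det A| = `|d|)%N.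
Proof.
move=> spanA.
have /fin_all_exists[c Ac] k : exists c, A *m c = col k (slice_basis d).
  apply: spanA => [i|].
    rewrite !mxE addr_ge0 ?mulr_ge0 ?ler0n // subr_ge0 -gtz0_ge1 //.
  under eq_bigr do rewrite !mxE.
  rewrite big_split /= (bigD1 k) //= eqxx big1 ?addr0 => [|i /negbTE->//].
  rewrite (bigD1 ord0) //= big1 ?addr0 => [|i /negbTE->]; last by rewrite mul0r.
  by rewrite mul1r addrC subrK.
pose X := \matrix_(i, k) c k i 0.
have AX : A *m X = slice_basis d.
  apply/matrixP => i k; move/matrixP/(_ i 0): (Ac k); rewrite [RHS]mxE => <-.
  by rewrite !mxE; apply: eq_bigr => j _; rewrite !mxE.
apply/eqP; rewrite absz_det_slice_coord unitmxE; apply/unitrPr.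
exists (\det X); apply: (mulfI (lt0r_neq0 d_gt0)).
by rewrite mulrA -det_slice_coord -det_mulmx AX det_slice_basis mulr1.
Qed.

(** The determinant condition makes [slice_coord A] invertible over the integers, so the system can
    be solved in slice coordinates. No sign condition on [m] is involved. *)
Lemma absz_det_slice_span (m : 'cV[int]_n.+1) :
  (`|\det A| = `|d|)%N -> \sum_i m i 0 = d -> exists c, A *m c = m.
Proof.
move/eqP; rewrite absz_det_slice_coord => uA sum_m.
exists (invmx (slice_coord A) *m slice_coord m).
rewrite -{1}(slice_coordK sumA) -mulmxA mulKVmx // slice_coordK // => j.
by rewrite ord1.
Qed.

End IntMatrices.

(** * The determinant criterion for equality of the two fraction fields *)

Section CremonaDet.
Variables (K : fieldType) (n : nat) (F : n.+1.-tuple 'X_{1..n.+1}).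

Definition in_monalg := gen_subalg (fun f => f \in monomials K F).

Definition int_log_matrix : 'M[int]_n.+1 := map_mx Posz (log_matrix F).

(** The exponent vector of the product of the [f_j ^ a_j]. *)
Definition monom_comb (a : 'I_n.+1 -> nat) : 'X_{1..n.+1} :=
  [multinom (\sum_j tnth F j i * a j)%N | i < n.+1].

Lemma in_monalg1 : in_monalg 1.
Proof. rewrite -[1]scale1r; exact: gen_subalg_scalar. Qed.

Lemma in_monalg_exp p k : in_monalg p -> in_monalg (p ^+ k).
Proof.
move=> Sp; elim: k => [|k IHk]; first exact: in_monalg1.
by rewrite exprS; apply: gen_subalg_mul.
Qed.

Lemma in_monalg_comb a : in_monalg 'X_[monom_comb a].
Proof.
have -> : monom_comb a = (\sum_j (tnth F j *+ a j))%MM.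
  by apply/mnmP => i; rewrite mnmE mnm_sumE; apply: eq_bigr => j _; rewrite mulmnE.
rewrite (big_morph _ (@mpolyXD _ K) (@mpolyX0 _ K)).
elim/big_rec: _ => [|j p _ Sp]; first exact: in_monalg1.
apply: gen_subalg_mul => //; rewrite -mpolyXn; apply: in_monalg_exp.
by apply: gen_subalg_mem; apply: map_f; apply: mem_tnth.
Qed.

(** Induction on the generation of [p]: supports of sums lie in unions, supports of products in
    Minkowski sums, and the vectors [monom_comb a] are closed under addition. *)
Lemma msupp_in_monalg p m :
  in_monalg p -> m \in msupp p -> exists a, m = monom_comb a.
Proof.
move=> Sp; elim: Sp m => {p} [p Sp|c|p q _ IHp _ IHq|p q _ IHp _ IHq] m.
- case/mapP: Sp => f /tnthP[j ->] ->; rewrite msuppX inE => /eqP->.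
  exists (fun k => k == j); apply/mnmP => i.
  rewrite mnmE (bigD1 j) //= eqxx muln1 big1 ?addn0 // => k /negbTE->.
  by rewrite muln0.
- move/msuppZ_le; rewrite msupp1 inE => /eqP->.
  exists (fun=> 0%N); apply/mnmP => i.
  by rewrite !mnmE big1 // => j _; rewrite muln0.
- by move/msuppD_le; rewrite mem_cat => /orP[/IHp|/IHq].
move/msuppM_le/allpairsP => [[m1 m2] /= [/IHp[a ->] /IHq[b ->] ->]].
exists (fun j => (a j + b j)%N); apply/mnmP => i.
by rewrite !mnmE -big_split; apply: eq_bigr => j _; rewrite mulnDr.
Qed.

Variable d : nat.
Hypotheses (d_gt0 : (0 < d)%N) (degF : of_degree d F).

Lemma sum_int_log_matrix j : \sum_i int_log_matrix i j = d%:Z.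
Proof.
rewrite -(degF j) mdegE (big_morph Posz PoszD (erefl _)).
by apply: eq_bigr => i _; rewrite !mxE.
Qed.

Lemma comb_span (m : 'X_{1..n.+1}) a b :
  (m + monom_comb a)%MM = monom_comb b ->
  int_log_matrix *m (\col_j ((b j)%:Z - (a j)%:Z)) = \col_i (m i)%:Z.
Proof.
move/mnmP => eq_m; apply/colP => i; rewrite !mxE.
move: (eq_m i) => /(congr1 Posz); rewrite mnmDE PoszD !mnmE => /(canRL (addrK _)) ->.
rewrite !(big_morph Posz PoszD (erefl _)) -sumrB.
by apply: eq_bigr => j _; rewrite !mxE mulrBr -!PoszM.
Qed.

Lemma span_comb (m : 'X_{1..n.+1}) c :
  int_log_matrix *m c = \col_i (m i)%:Z ->
  exists a b, (m + monom_comb a)%MM = monom_comb b.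
Proof.
move/colP => eq_m.
(* Negative and positive parts of [c]; [Negz k] stands for [-(k + 1)], whence [k.+1]. *)
pose a j := if c j 0 is Negz k then k.+1 else 0%N.
pose b j := if c j 0 is Posz k then k else 0%N.
exists a, b; apply/mnmP => i; apply/eqP; rewrite -eqz_nat mnmDE PoszD !mnmE.
move: (eq_m i); rewrite [RHS]mxE => <-.
rewrite !(big_morph Posz PoszD (erefl _)) mxE -big_split /=; apply/eqP.
apply: eq_bigr => j _; rewrite !mxE !PoszM -mulrDr; congr (_ * _).
by rewrite /a /b; case: (c j 0) => k; rewrite ?addr0 // NegzE addNr.
Qed.

(** For [m] of degree [d], write ['X_[m] = p / q] over the monomial algebra. The leading exponent of
    [q], shifted by [m], lies in the support of [p], so [m] is a difference of two vectors
    [monom_comb]. *)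
Lemma frac_veronese_span :
  (forall z : {fraction {mpoly K[n.+1]}},
     frac_of (@veronese n.+1 K d) z -> frac_of in_monalg z) ->
  (`|\det int_log_matrix| = d)%N.
Proof.
move=> sub; apply: (slice_span_absz_det (d := d)) => //.
  exact: sum_int_log_matrix.
move=> v v_ge0 sum_v.
pose m : 'X_{1..n.+1} := [multinom `|v i 0%R|%N | i < n.+1].
have mE i : (m i)%:Z = v i 0 by rewrite mnmE gez0_abs.
have -> : v = \col_i (m i)%:Z by apply/colP => i; rewrite mxE mE.
have deg_m : mdeg m = d.
  apply/eqP; rewrite -eqz_nat mdegE (big_morph Posz PoszD (erefl _)) -sum_v.
  by apply/eqP/eq_bigr => i _; rewrite mE.
have [|p [q [Sp Sq q0]]] := sub (tofrac 'X_[m]).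
  exists 'X_[m], 1; split; rewrite ?oner_neq0 ?tofrac1 ?divr1 //.
    by apply: gen_subalg_mem; exists m.
  by rewrite -[1]scale1r; apply: gen_subalg_scalar.
have q0' : tofrac q != 0 by rewrite tofrac_eq0.
move/(canLR (divfK q0'))/esym/eqP; rewrite -tofracM tofrac_eq => /eqP Xq.
have [a qa] := msupp_in_monalg Sq (mlead_supp q0).
have [|b pb] := @msupp_in_monalg p (m + mlead q)%MM Sp.
  by rewrite Xq mulrC mcoeff_msupp mcoeffMX -mcoeff_msupp mlead_supp.
by exists (\col_j ((b j)%:Z - (a j)%:Z)); apply: comb_span; rewrite -qa.
Qed.

(** For a generator ['X_[m]], the spanning property gives a monomial denominator. For sums and
    products, the denominators are multiplied. *)
Lemma veronese_denominator (p : {mpoly K[n.+1]}) :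
  (`|\det int_log_matrix| = d)%N -> @veronese n.+1 K d p ->
  exists q, [/\ in_monalg q, q != 0 & in_monalg (p * q)].
Proof.
move=> detA; elim=> {p} [_ [m deg_m ->]|c|p q _ IHp _ IHq|p q _ IHp _ IHq].
- have [||c Ac] := absz_det_slice_span (d := d) d_gt0 sum_int_log_matrix
    (m := \col_i (m i)%:Z).
  + exact: detA.
  + rewrite -deg_m mdegE (big_morph Posz PoszD (erefl _)).
    by apply: eq_bigr => i _; rewrite mxE.
  have [a [b mab]] := span_comb Ac.
  exists 'X_[monom_comb a]; split; first exact: in_monalg_comb.
    by rewrite -msupp_eq0 msuppX.
  by rewrite -mpolyXD mab; apply: in_monalg_comb.
- exists 1; split; rewrite ?oner_neq0 ?mulr1 //; first exact: in_monalg1.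
  exact: gen_subalg_scalar.
- have [u [Su u0 Spu]] := IHp; have [v [Sv v0 Sqv]] := IHq.
  exists (u * v); split; rewrite ?mulf_neq0 //; first exact: gen_subalg_mul.
  rewrite mulrDl mulrA [u * v]mulrC mulrA.
  by apply: gen_subalg_add; apply: gen_subalg_mul.
have [u [Su u0 Spu]] := IHp; have [v [Sv v0 Sqv]] := IHq.
exists (u * v); split; rewrite ?mulf_neq0 //; first exact: gen_subalg_mul.
by rewrite mulrACA; apply: gen_subalg_mul.
Qed.

Lemma in_monalg_veronese p : in_monalg p -> @veronese n.+1 K d p.
Proof.
elim=> {p} [p|c|p q _ Vp _ Vq|p q _ Vp _ Vq].
- case/mapP=> _ /tnthP[j ->] ->; apply: gen_subalg_mem.
  by exists (tnth F j); first exact: degF.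
- exact: gen_subalg_scalar.
- exact: gen_subalg_add.
exact: gen_subalg_mul.
Qed.

Lemma frac_monalg_veroneseP :
  (forall z : {fraction {mpoly K[n.+1]}},
     frac_of in_monalg z <-> frac_of (@veronese n.+1 K d) z) <->
  (`|\det int_log_matrix| = d)%N.
Proof.
split=> [eq_frac|detA z]; first by apply: frac_veronese_span => z /eq_frac.
split=> -[p [q [Sp Sq q0 ->]]].
  by exists p, q; split=> //; apply: in_monalg_veronese.
have [u [Su u0 Spu]] := veronese_denominator detA Sp.
have [v [Sv v0 Sqv]] := veronese_denominator detA Sq.
(* Here [u] clears [p] and [v] clears [q]; multiplying both by [u * v] leaves the fraction
   unchanged. *)
exists (p * u * v), (q * v * u); split; rewrite ?mulf_neq0 //.
- exact: gen_subalg_mul.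
- exact: gen_subalg_mul.
rewrite !tofracM [tofrac q * _ * _]mulrAC -!(mulrA _ (tofrac u)) -mulf_div.
rewrite divff ?mulr1 //.
by rewrite mulf_neq0 // tofrac_eq0.
Qed.

End CremonaDet.

(** * Determinants that evaluate by computation *)

(** A fold over [iota], with a parity test for the sign, reduces under [vm_compute], which the
    locked big operators do not. *)
Definition signed_sum n (f : nat -> int) : int :=
  foldr (fun j acc => (if odd j then - f j else f j) + acc) 0 (iota 0 n).

(* Computable Laplace expansion along the first row; bump j skips the j-th column. *)
Fixpoint laplace n (a : nat -> nat -> int) : int :=
  if n is n'.+1 then
    signed_sum n (fun j => if a 0%N j == 0 then 0
      else a 0%N j * laplace n' (fun i k => a i.+1 (bump j k)))
  else 1.

Lemma signed_sumE n f : signed_sum n f = \sum_(j < n) (-1) ^+ j * f j.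
Proof.
rewrite -(big_mkord xpredT (fun j => (-1) ^+ j * f j)) /index_iota subn0.
rewrite /signed_sum; elim: (iota 0 n) => [|j r IHr] /=; first by rewrite big_nil.
rewrite big_cons IHr -signr_odd.
by case: odd; rewrite ?expr1 ?expr0 ?mulN1r ?mul1r.
Qed.

Lemma det_laplace n (a : nat -> nat -> int) :
  \det (\matrix_(i < n, j < n) a i j) = laplace n a.
Proof.
elim: n a => [|n IHn] a; first by rewrite det_mx00.
rewrite (expand_det_row _ ord0) [RHS]signed_sumE.
apply: eq_bigr => j _; rewrite mxE /cofactor add0n mulrCA.
case: eqP => [->|_]; first by rewrite mul0r.
congr (_ * (_ * _)); rewrite -[RHS]IHn; congr (\det _).
by apply/matrixP => i k; rewrite !mxE.
Qed.

Local Close Scope ring_scope.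

(** * Sets of monomials as lists of 0/1 vectors, and the finite checks *)

Section ExponentLists.
Implicit Types (v p : seq nat) (S : seq (seq nat)).

(** The permutation [p] is stored as its list of values: position [i] of the result reads the old
    variable [p_i]. *)
Definition relabel p v := [seq nth 0 v i | i <- p].

Definition row_deg i S := count (fun v => nth 0 v i == 1) S.

Definition list_det n S : int := laplace n (fun j i => (nth 0 (nth [::] S j) i)%:Z%R).

Fixpoint cube n : seq (seq nat) :=
  if n is n'.+1 then
    [seq 0 :: v | v <- cube n'] ++ [seq 1 :: v | v <- cube n']
  else [:: [::]].

Lemma mem_cube n v : (v \in cube n) = (size v == n) && all (fun x => x < 2) v.
Proof.
elim: n v => [|n IHn] [|x v] //=; rewrite mem_cat.
  by apply/norP; split; apply/mapP => -[].
rewrite eqSS andbCA -IHn; apply/orP/andP => [[] /mapP[w w_n [-> ->]] //|].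
by case: x => [|[|x]] [// _ v_n]; [left|right]; apply: map_f.
Qed.

Definition triples := [seq v <- cube 6 | sumn v == 3].

(* S is the list of rows of the transposed log matrix; row_deg i counts the monomials
   containing x_i, so the values 0 and 6 are excluded by the canonical restrictions and
   the value 5 by type 1. *)
Definition good S :=
  [&& size S == 6, all (mem triples) S,
      all (fun i => row_deg i S \in [:: 1; 2; 3; 4]) (iota 0 6),
      has (fun i => row_deg i S == 1) (iota 0 6) & `|list_det 6 S|%N == 3].

(** Keeping the order of [s] lists each [k]-element subset of a repetition-free [s] once, hence 252
    cases for 5 out of the ten vectors of [triples5]. *)
Fixpoint subseqs (T : Type) k (s : seq T) : seq (seq T) :=
  match s with
  | [::] => if k is 0 then [:: [::]] else [::]
  | x :: s' =>
      (if k is k'.+1 then [seq x :: t | t <- subseqs k' s'] else [::])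
        ++ subseqs k s'
  end.

Lemma mem_subseqs (T : eqType) (s t : seq T) :
  subseq t s -> t \in subseqs (size t) s.
Proof.
elim: s t => [|x s IHs] [|y t] //=; first by move=> _; apply: IHs (sub0seq s).
rewrite mem_cat; case: eqP => [-> /IHs t_s|_ /IHs t_s]; last by rewrite t_s orbT.
by rewrite map_f.
Qed.

Definition indicator (s : seq nat) := [seq ((i \in s) : nat) | i <- iota 0 6].

(** Supports of the monomials, one set per class, in normal form: the first support is the only one
    containing 5. *)
Definition representatives := map (map indicator)
 [:: [:: [:: 3; 4; 5]; [:: 0; 1; 2]; [:: 0; 1; 3]; [:: 0; 1; 4]; [:: 0; 2; 3]; [:: 1; 2; 3]];
     [:: [:: 3; 4; 5]; [:: 0; 1; 2]; [:: 0; 1; 3]; [:: 0; 1; 4]; [:: 0; 2; 3]; [:: 1; 2; 4]];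
     [:: [:: 3; 4; 5]; [:: 0; 1; 2]; [:: 0; 1; 3]; [:: 0; 1; 4]; [:: 0; 2; 3]; [:: 1; 3; 4]];
     [:: [:: 3; 4; 5]; [:: 0; 1; 2]; [:: 0; 1; 3]; [:: 0; 1; 4]; [:: 0; 2; 3]; [:: 2; 3; 4]];
     [:: [:: 3; 4; 5]; [:: 0; 1; 2]; [:: 0; 1; 3]; [:: 0; 1; 4]; [:: 0; 3; 4]; [:: 1; 3; 4]];
     [:: [:: 3; 4; 5]; [:: 0; 1; 2]; [:: 0; 1; 3]; [:: 0; 1; 4]; [:: 0; 3; 4]; [:: 2; 3; 4]];
     [:: [:: 3; 4; 5]; [:: 0; 1; 2]; [:: 0; 1; 3]; [:: 0; 2; 3]; [:: 0; 3; 4]; [:: 1; 2; 4]];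
     [:: [:: 3; 4; 5]; [:: 0; 1; 2]; [:: 0; 1; 3]; [:: 0; 2; 4]; [:: 1; 3; 4]; [:: 2; 3; 4]];
     [:: [:: 3; 4; 5]; [:: 0; 1; 3]; [:: 0; 1; 4]; [:: 0; 2; 3]; [:: 0; 3; 4]; [:: 1; 2; 4]];
     [:: [:: 3; 4; 5]; [:: 0; 1; 3]; [:: 0; 1; 4]; [:: 0; 2; 3]; [:: 1; 2; 4]; [:: 2; 3; 4]]].

Definition perms6 := permutations (iota 0 6).

(* Permutations fixing both the variable x_5 and the monomial x_3 x_4 x_5. *)
Definition stab6 :=
  [seq p ++ q ++ [:: 5] | p <- permutations [:: 0; 1; 2], q <- permutations [:: 3; 4]].

Definition triples5 := [seq v <- triples | nth 0 v 5 == 0].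

Lemma representatives_good : all (fun R => uniq R && good R) representatives.
Proof. by vm_compute. Qed.

(** All 720 permutations are tried. An isomorphism would give an inclusion of the relabelled set, so
    refuting inclusions is enough. *)
Lemma representatives_nonisomorphic :
  all (fun k => all (fun l => (k == l) ||
     all (fun p => ~~ all (fun v => relabel p v \in nth [::] representatives l)
             (nth [::] representatives k)) perms6) (iota 0 10)) (iota 0 10).
Proof. by vm_compute. Qed.

(** Permutations act transitively on pairs of a triple and one of its elements; [nth 0 p 5 == i]
    says that the old variable [i] becomes [x_5]. *)
Lemma normalise_triple :
  all (fun v => all (fun i => (nth 0 v i == 1) ==>
     has (fun p => (relabel p v == indicator [:: 3; 4; 5]) && (nth 0 p 5 == i)) perms6)
   (iota 0 6)) triples.
Proof. by vm_compute. Qed.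

(** Only an inclusion into a relabelled representative is tested; equality follows later because
    both lists have six elements. *)
Lemma normalised_good_classified :
  all (fun S => let S' := indicator [:: 3; 4; 5] :: S in
    good S' ==> has (fun R => has (fun p => 
      all (mem [seq relabel p v | v <- R]) S') stab6) representatives)
   (subseqs 5 triples5).
Proof. by vm_compute. Qed.
End ExponentLists.

(** * Permutations as lists, and invariance of [good] under reordering and relabelling *)

Definition perm_seq n (s : 'S_n) : seq nat := [seq val (s i) | i <- enum 'I_n].

Lemma size_perm_seq n (s : 'S_n) : size (perm_seq s) = n.
Proof. by rewrite size_map size_enum_ord. Qed.

Lemma nth_perm_seq n (s : 'S_n) (i : 'I_n) : nth 0 (perm_seq s) i = s i.
Proof. by rewrite (nth_map i) ?size_enum_ord // nth_ord_enum. Qed.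

Lemma perm_seqP n (p : seq nat) :
  reflect (exists s : 'S_n, p = perm_seq s) (perm_eq p (iota 0 n)).
Proof.
apply: (iffP idP) => [p_n|[s ->]]; last first.
  rewrite -val_enum_ord /perm_seq (map_comp val s) perm_map //.
  apply: uniq_perm; rewrite ?(map_inj_uniq (@perm_inj _ s)) ?enum_uniq //.
  by move=> i; rewrite -[i in LHS](permKV s) mem_map ?mem_enum //; apply: perm_inj.
have sz_p : size p = n by rewrite (perm_size p_n) size_iota.
have lt_p (i : 'I_n) : (nth 0 p i < n).
  have : nth 0 p i \in p by rewrite mem_nth ?sz_p.
  by rewrite (perm_mem p_n) mem_iota.
have inj_p : injective (fun i => Ordinal (lt_p i)).
  move=> i j /(congr1 val) /= /eqP.
  rewrite nth_uniq ?sz_p ?(perm_uniq p_n) ?iota_uniq // => /eqP; exact: val_inj.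
exists (perm inj_p); apply: (@eq_from_nth _ 0); rewrite ?size_perm_seq // sz_p.
by move=> i lt_i; rewrite (nth_perm_seq _ (Ordinal lt_i)) permE.
Qed.

Lemma nth_relabel p v i :
  (i < size p) -> nth 0 (relabel p v) i = nth 0 v (nth 0 p i).
Proof. by move=> lt_i; rewrite (nth_map 0). Qed.

Lemma absz_det_row_perm n (s : 'S_n) (A : 'M[int]_n) :
  `|(\det (row_perm s A))%R|%N = `|(\det A)%R|%N.
Proof. by rewrite row_permE det_mulmx det_perm abszMsign. Qed.

Lemma absz_list_det_perm n S S' :
  size S = n -> perm_eq S S' -> `|list_det n S|%N = `|list_det n S'|%N.
Proof.
move=> szS eqS; have szS' : size S' == n by rewrite -(perm_size eqS) szS.
have /tuple_permP[s defS] : perm_eq S (Tuple szS') by [].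
rewrite /list_det -!det_laplace -[RHS](absz_det_row_perm s); congr (absz (\det _)%R).
apply/matrixP => i j; rewrite !mxE defS /=.
by rewrite -(tnth_nth [::] [tuple _ | _ < _]) tnth_mktuple (tnth_nth [::]).
Qed.

(** Reordering [S] permutes the rows of its matrix, while relabelling permutes the columns;
    transposing reduces this to a row permutation, which only affects the sign. *)
Lemma absz_list_det_relabel n (s : 'S_n) S :
  size S = n ->
  `|list_det n [seq relabel (perm_seq s) v | v <- S]|%N = `|list_det n S|%N.
Proof.
move=> szS; rewrite /list_det -!det_laplace -[in RHS]det_tr.
rewrite -[RHS](absz_det_row_perm s) -[in RHS]det_tr; congr (absz (\det _)%R).
apply/matrixP => i j; rewrite !mxE (nth_map [::]) ?szS //.
by rewrite nth_relabel ?size_perm_seq // nth_perm_seq.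
Qed.

Lemma mem_triples v :
  (v \in triples) = [&& sumn v == 3, size v == 6 & all (fun x => x < 2) v].
Proof. by rewrite mem_filter mem_cube. Qed.

Lemma good_perm S S' : perm_eq S S' -> good S -> good S'.
Proof.
move=> eqS /and5P[szS tS degS oneS detS].
have degE i : row_deg i S' = row_deg i S by apply/esym/seq.permP.
apply/and5P; split.
- by rewrite -(perm_size eqS).
- by rewrite -(perm_all _ eqS).
- by apply: sub_all degS => i; rewrite degE.
- by apply: sub_has oneS => i; rewrite degE.
by rewrite -(absz_list_det_perm (eqP szS) eqS).
Qed.

Lemma row_deg_relabel p i S :
  (i < size p) -> row_deg i (map (relabel p) S) = row_deg (nth 0 p i) S.
Proof.
by move=> lt_i; rewrite /row_deg count_map; apply: eq_count => v /=; rewrite nth_relabel.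
Qed.

Lemma good_relabel p S : perm_eq p (iota 0 6) -> good S -> good (map (relabel p) S).
Proof.
move=> p6 /and5P[szS tS degS oneS detS].
have szp : size p = 6 by rewrite (perm_size p6).
have degE i : i \in iota 0 6 ->
    row_deg i (map (relabel p) S) = row_deg (nth 0 p i) S.
  by rewrite mem_iota => lt_i; rewrite row_deg_relabel ?szp.
(* Needed to write a row [j] with a single 1 as [p_i], so that row [i] after relabelling has a
   single 1. *)
have p_nth : p = [seq nth 0 p i | i <- iota 0 6].
  by rewrite -[6]szp -/(mkseq _ _) mkseq_nth.
apply/and5P; split.
- by rewrite size_map.
- apply/allP => _ /mapP[v /(allP tS) /= + ->].
  rewrite !mem_triples size_map szp => /and3P[/eqP sum_v /eqP sz_v lt_v].
  have eq_v : perm_eq (relabel p v) v.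
    rewrite -[X in perm_eq _ X](mkseq_nth 0 v) /mkseq sz_v; exact: perm_map.
  by rewrite (perm_all _ eq_v) (perm_sumn eq_v) sum_v.
- apply/allP => i i6; rewrite degE //; apply: (allP degS).
  by rewrite -(perm_mem p6) mem_nth // szp; move: i6; rewrite mem_iota.
- have /hasP[j j6 oneSj] := oneS; apply/hasP.
  move: j6 oneSj; rewrite -(perm_mem p6) {1}p_nth => /mapP[i i6 ->] oneSi.
  by exists i; rewrite ?degE.
have /perm_seqP[s ->] := p6.
by rewrite absz_list_det_relabel // (eqP szS).
Qed.

(** * Translation between tuples of monomials and lists of exponents *)

Definition exps n (F : seq 'X_{1..n}) : seq (seq nat) :=
  [seq (m : seq nat) | m : 'X_{1..n} <- F].

Lemma exps_inj n : injective (fun m : 'X_{1..n} => m : seq nat).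
Proof. by move=> m1 m2 /val_inj/val_inj. Qed.

Lemma size_exps n (F : seq 'X_{1..n}) : size (exps F) = size F.
Proof. exact: size_map. Qed.

Lemma sumn_mnm n (m : 'X_{1..n}) : sumn m = mdeg m.
Proof. by rewrite sumnE. Qed.

Lemma nth_exps n (F : n.-tuple 'X_{1..n}) (i j : 'I_n) :
  nth 0 (nth [::] (exps F) j) i = log_matrix F i j.
Proof.
by rewrite mxE (nth_map (tnth F j)) ?size_tuple // -mnm_nth -tnth_nth.
Qed.

Lemma row_ones_exps n (F : n.-tuple 'X_{1..n}) (i : 'I_n) :
  row_ones (log_matrix F) i = row_deg i (exps F).
Proof.
rewrite /row_ones /row_deg cardsE cardE /enum_mem size_filter count_map.
rewrite -[in RHS](map_tnth_enum F) count_map enumT.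
by apply: eq_count => j; rewrite /= unfold_in mxE -mnm_nth.
Qed.

Lemma row_ones_canonical n (F : n.-tuple 'X_{1..n}) : square_free F ->
  canonical_restrictions F <-> (forall i, 0 < row_ones (log_matrix F) i < n).
Proof.
move=> sfF; split=> H i; last first.
  have /andP[] := H i; rewrite /row_ones => /card_gt0P[j]; rewrite inE => /eqP Aij.
  move=> lt_n; split; first by exists j; rewrite Aij.
  have /subsetPn[k _] : ~~ (setT \subset [set j | log_matrix F i j == 1]).
    by apply: contraL lt_n => /subset_leq_card; rewrite cardsT card_ord -leqNgt.
  by rewrite inE => Aik1; exists k; case/or3P: (sfF i k) Aik1 => // /eqP->.
have [[j Aij] [k Aik]] := H i; apply/andP; split.
  apply/card_gt0P; exists j; rewrite inE.
  by case/or3P: (sfF i j) Aij => // /eqP->.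
rewrite -[X in _ < X]card_ord -cardsT; apply/proper_card/properP.
by split; [exact: subsetT | exists k; rewrite inE ?Aik].
Qed.

Lemma square_free_exps (F : 6.-tuple 'X_{1..6}) :
  (of_degree 3 F /\ square_free F) <-> all (mem triples) (exps F).
Proof.
rewrite /exps all_map; split=> [[degF sfF]|/all_tnthP tF].
  apply/all_tnthP => j; rewrite /= mem_triples sumn_mnm degF size_tuple /=.
  apply/all_tnthP => i; rewrite -mnm_tnth.
  by have := sfF i j; rewrite mxE !inE => /orP[] /eqP->.
split=> [j|i j]; have := tF j; rewrite /= mem_triples => /and3P[].
  by rewrite sumn_mnm => /eqP.
move=> _ _ /all_tnthP/(_ i); rewrite -mnm_tnth mxE.
by case: (tnth F j i) => [|[|]].
Qed.

Lemma all_iotaP n (Q : pred nat) :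
  reflect (forall i : 'I_n, Q i) (all Q (iota 0 n)).
Proof.
rewrite -val_enum_ord all_map; apply: (iffP allP) => [H i|H i _] /=; last exact: H.
by apply: H; rewrite mem_enum.
Qed.

Lemma has_iotaP n (Q : pred nat) :
  reflect (exists i : 'I_n, Q i) (has Q (iota 0 n)).
Proof.
rewrite -val_enum_ord has_map; apply: (iffP hasP) => [[i _ Qi]|[i Qi]].
  by exists i.
by exists i; rewrite ?mem_enum.
Qed.

Lemma absz_det_exps n (F : n.+1.-tuple 'X_{1..n.+1}) :
  `|(\det (int_log_matrix F))%R|%N = `|list_det n.+1 (exps F)|%N.
Proof.
rewrite /list_det -det_laplace -det_tr; congr (absz (\det _)%R).
by apply/matrixP => i j; rewrite [RHS]mxE nth_exps !mxE.
Qed.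

(** The determinant criterion turns the field condition into a numerical one, so the right-hand side
    no longer mentions [K]. Canonical restrictions together with the absence of a row of five ones
    leave the row counts 1 to 4. *)
Lemma type1_cremona_good (K : fieldType) (F : 6.-tuple 'X_{1..6}) :
  [/\ cremona_set K 3 F, square_free F & type1 (log_matrix F)] <->
  uniq F && good (exps F).
Proof.
have degs i : (0 < row_ones (log_matrix F) i < 6) ->
    row_ones (log_matrix F) i <> 5 -> row_deg i (exps F) \in [:: 1; 2; 3; 4].
  by rewrite row_ones_exps; case: row_deg => [|[|[|[|[|[|d]]]]]].
split=> [[[uF degF canF cremF] sfF [no5 one1]]|].
  rewrite uF /=; apply/and5P; split.
  - by rewrite size_exps size_tuple.
  - exact/square_free_exps.
  - apply/all_iotaP => i; apply: degs; first exact: (row_ones_canonical sfF).1.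
    by move=> deg5; apply: no5; exists i.
  - by apply/has_iotaP; have [i degi] := one1; exists i; rewrite -row_ones_exps degi.
  by rewrite -absz_det_exps; apply/eqP/(frac_monalg_veroneseP K).
case/andP=> uF /and5P[_ /square_free_exps[degF sfF]].
move=> /all_iotaP degs' /has_iotaP[i0 deg1] /eqP detF.
split=> //; last first.
  split; first by case=> i; rewrite row_ones_exps => d5; have := degs' i; rewrite d5.
  by exists i0; rewrite row_ones_exps; apply/eqP.
split=> //.
  apply/(row_ones_canonical sfF) => i; rewrite row_ones_exps.
  by move: (degs' i); rewrite !inE => /or4P[] /eqP->.
by apply/frac_monalg_veroneseP; rewrite // absz_det_exps.
Qed.

Lemma exps_mperm n (s : 'S_n) (m : 'X_{1..n}) :
  [multinom m (s i) | i < n] = relabel (perm_seq s) m :> seq nat.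
Proof.
by rewrite /relabel /perm_seq -map_comp; apply: eq_map => i; rewrite (mnm_nth 0).
Qed.

Lemma mpolyX_inj (K : fieldType) n : injective (fun m => 'X_[m] : {mpoly K[n]}).
Proof. by move=> m1 m2 /(congr1 (@msupp _ _)); rewrite !msuppX => -[]. Qed.

(** [msym s] permutes exponents by the inverse of [s], so [p] is the value list of that inverse.
    Injectivity of exponents to monomials and to lists transfers [perm_eq]. *)
Lemma isomorphicP (K : fieldType) n (F F' : n.-tuple 'X_{1..n}) :
  isomorphic K F F' <->
  exists2 p, perm_eq p (iota 0 n) & perm_eq (exps F') (map (relabel p) (exps F)).
Proof.
have eq_msym s : [seq msym s f | f <- monomials K F] =
    [seq 'X_[m] | m <- [seq [multinom m ((s^-1)%g i) | i < n] | m : 'X_{1..n} <- F]].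
  by rewrite /monomials -!map_comp; apply: eq_map => m /=; rewrite msymX.
have eq_exps s : map (relabel (perm_seq s)) (exps F) =
    exps [seq [multinom m (s i) | i < n] | m : 'X_{1..n} <- F].
  by rewrite /exps -!map_comp; apply: eq_map => m; rewrite /= exps_mperm.
split=> [[s]|[_ /perm_seqP[s ->]]].
  rewrite eq_msym => /(perm_map_inj (@mpolyX_inj K n)) eqF.
  exists (perm_seq s^-1); first by apply/perm_seqP; exists s^-1%g.
  by rewrite eq_exps; apply: perm_map.
rewrite eq_exps => /(perm_map_inj (@exps_inj n)) eqF.
by exists s^-1%g; rewrite eq_msym invgK; apply: perm_map.
Qed.

Lemma isomorphic_sym (K : fieldType) n (F F' : n.-tuple 'X_{1..n}) :
  isomorphic K F F' -> isomorphic K F' F.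
Proof.
case=> s eqF; exists s^-1%g; rewrite perm_sym.
apply: perm_trans (perm_map (msym s^-1%g) eqF) _.
by rewrite -map_comp map_id_in // => f _ /=; rewrite -msymMm mulgV msym1m.
Qed.

Lemma isomorphic_trans (K : fieldType) n (F F' F'' : n.-tuple 'X_{1..n}) :
  isomorphic K F F' -> isomorphic K F' F'' -> isomorphic K F F''.
Proof.
case=> s eqF [s' eqF']; exists (s * s')%g; apply: perm_trans eqF' _.
apply: perm_trans (perm_map (msym s') eqF) _.
by rewrite -map_comp (eq_map (fun f => esym (msymMm f s s'))).
Qed.

(** Inverse of [exps] on good lists, where six vectors of length 6 mean that the default values are
    never read. *)
Definition tuple_of_exps (S : seq (seq nat)) : 6.-tuple 'X_{1..6} :=
  [tuple [multinom nth 0 (nth [::] S j) i | i < 6] | j < 6].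

Lemma tuple_of_expsK S : good S -> exps (tuple_of_exps S) = S.
Proof.
case/and5P=> /eqP szS /allP tS _ _ _.
apply: (@eq_from_nth _ [::]); rewrite size_exps size_tuple // => j lt_j.
have /tS : nth [::] S j \in S by rewrite mem_nth ?szS.
rewrite /= mem_triples => /and3P[_ /eqP szv _].
pose j' := Ordinal lt_j; rewrite -[j]/(val j').
have -> : nth [::] (exps (tuple_of_exps S)) j' = tnth (tuple_of_exps S) j'.
  by rewrite (nth_map (tnth (tuple_of_exps S) j')) ?size_tuple // -tnth_nth.
apply: (@eq_from_nth _ 0) => [|i]; rewrite size_tuple ?szv // => lt_i.
by rewrite -[i]/(val (Ordinal lt_i)) -mnm_nth tnth_mktuple mnmE.
Qed.

(** * Normal forms and the classification *)

Lemma mem_triples5 v : (v \in triples5) = (nth 0 v 5 == 0) && (v \in triples).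
Proof. exact: mem_filter. Qed.

Lemma relabel_inj p n :
  perm_eq p (iota 0 n) -> {in [pred v | size v == n] &, injective (relabel p)}.
Proof.
move=> p_n v w /eqP sz_v /eqP sz_w /eq_in_map eq_vw.
apply: (@eq_from_nth _ 0) => [|i]; rewrite sz_v ?sz_w // => lt_i.
by apply: eq_vw; rewrite (perm_mem p_n) mem_iota.
Qed.

(** A variable occurring in a single monomial is moved to [x_5] and that monomial to [x_3 x_4 x_5];
    the other five then avoid [x_5]. *)
Lemma good_normal_form S : uniq S -> good S ->
  exists p S', [/\ perm_eq p (iota 0 6), S' \in subseqs 5 triples5,
      uniq (indicator [:: 3; 4; 5] :: S')
    & perm_eq (map (relabel p) S) (indicator [:: 3; 4; 5] :: S')].
Proof.
set e := indicator _ => uS gS; have [/eqP szS /allP tS _ /hasP[i i6 /eqP deg_i] _] := and5P gS.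
have /hasP[v vS vi] : has (fun v => nth 0 v i == 1) S.
  by rewrite has_count -/(row_deg i S) deg_i.
have /hasP[p] := implyP (allP (allP normalise_triple _ (tS _ vS)) _ i6) vi.
rewrite /perms6 mem_permutations -/e => p6 /andP[/eqP pv /eqP p5].
have szp : size p = 6 by rewrite (perm_size p6).
pose S1 := map (relabel p) S.
have gS1 : good S1 := good_relabel p6 gS.
have [_ /allP tS1 _ _ _] := and5P gS1.
have uS1 : uniq S1.
  rewrite map_inj_in_uniq // => u w /tS + /tS; rewrite /= !mem_triples.
  case/and3P=> _ szu _ /and3P[_ szw _]; exact: (relabel_inj p6).
have deg5 : row_deg 5 S1 = 1 by rewrite row_deg_relabel ?szp // p5.
have eS1 : e \in S1 by rewrite -pv map_f.
have only_e u : u \in S1 -> u != e -> nth 0 u 5 = 0.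
  move=> uS1' neq_u; have /tS1 := uS1'; rewrite /= mem_triples => /and3P[_ /eqP szu lt_u].
  have : nth 0 u 5 < 2 by apply: (allP lt_u); rewrite mem_nth ?szu.
  case E: (nth 0 u 5) => [|[|]] // _; move: deg5.
  rewrite /row_deg (seq.permP (perm_to_rem eS1)) /= => -[/eqP].
  rewrite -leqn0 leqNgt -has_count => /hasPn/(_ u).
  by rewrite (mem_rem_uniq _ uS1) !inE neq_u uS1' E => /(_ isT).
(* Filtering [triples5] puts the five other vectors in the order in which [subseqs] enumerates
   them. *)
have eqS1 : perm_eq S1 (e :: [seq u <- triples5 | u \in S1]).
  apply: uniq_perm => // [|u].
    by rewrite cons_uniq mem_filter mem_triples5 andbF filter_uniq.
  rewrite inE mem_filter mem_triples5.
  have [-> //|neq_u /=] := eqVneq u e.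
  apply/idP/and3P => [uS1'|[]//].
  by split=> //; [rewrite only_e | apply: tS1].
exists p, [seq u <- triples5 | u \in S1]; split=> //; last by rewrite -(perm_uniq eqS1).
have sz5 : size [seq u <- triples5 | u \in S1] = 5.
  by have := perm_size eqS1; rewrite size_map szS => -[].
by have := mem_subseqs (filter_subseq (mem S1) triples5); rewrite sz5.
Qed.

Lemma stab6_perms : all (fun p => perm_eq p (iota 0 6)) stab6.
Proof. by vm_compute. Qed.

(** Relabelling both sides avoids inverting and composing permutation lists. *)
Lemma good_classified S : uniq S -> good S -> exists (k : 'I_10) p q,
  [/\ perm_eq p (iota 0 6), perm_eq q (iota 0 6)
    & perm_eq (map (relabel p) S) (map (relabel q) (nth [::] representatives k))].
Proof.
move=> uS gS; have [p [S' [p6 S'_sub uS' eqS]]] := good_normal_form uS gS.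
have gS' := good_perm eqS (good_relabel p6 gS).
have /hasP[R R_in /hasP[q q_in /allP subR]] :=
  implyP (allP normalised_good_classified _ S'_sub) gS'.
have lt_k : index R representatives < 10.
  by rewrite -[10]/(size representatives) index_mem.
exists (Ordinal lt_k), p, q; rewrite /= nth_index //; split=> //.
  exact: (allP stab6_perms).
apply: perm_trans eqS _.
have [_ /and5P[/eqP szR _ _ _ _]] := andP (allP representatives_good _ R_in).
have [/eqP szS' _ _ _ _] := and5P gS'.
(* Equal sizes and absence of repetitions upgrade the inclusion [subR] to equality of sets. *)
have le_sz : size (map (relabel q) R) <= size (indicator [:: 3; 4; 5] :: S').
  by rewrite size_map szR szS'.
apply: uniq_perm => //; first exact: leq_size_uniq subR le_sz.
by have [] := uniq_min_size uS' subR le_sz.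
Qed.

Lemma representative_good k : k < 10 ->
  uniq (nth [::] representatives k) && good (nth [::] representatives k).
Proof. by move=> lt_k; apply: (allP representatives_good); rewrite mem_nth. Qed.

Theorem proposition4p5 (K : fieldType) :
  let P (F : 6.-tuple 'X_{1..6}) :=
    [/\ cremona_set K 3 F, square_free F & type1 (log_matrix F)] in
  exists L : 10.-tuple (6.-tuple 'X_{1..6}),
    [/\ forall k, P (tnth L k),
        forall k l, isomorphic K (tnth L k) (tnth L l) -> k = l
      & forall F, P F -> exists k, isomorphic K (tnth L k) F].
Proof.
move=> P; pose R k := nth [::] representatives k.
have RK (k : 'I_10) : exps (tuple_of_exps (R k)) = R k.
  by have /andP[_ gR] := representative_good (ltn_ord k); apply: tuple_of_expsK.
exists [tuple tuple_of_exps (R k) | k < 10]; split=> [k|k l|F /type1_cremona_good].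
- rewrite tnth_mktuple; apply/type1_cremona_good.
  have /andP[uR gR] := representative_good (ltn_ord k).
  by rewrite -(map_inj_uniq (@exps_inj 6)) -/(exps _) RK uR.
- rewrite !tnth_mktuple => /isomorphicP[p p6]; rewrite !RK => eqR.
  have := allP representatives_nonisomorphic k; rewrite mem_iota ltn_ord.
  move=> /(_ isT)/allP/(_ (l : nat)); rewrite mem_iota ltn_ord => /(_ isT).
  case/orP=> [/eqP/val_inj //|/allP/(_ p)].
  rewrite /perms6 mem_permutations => /(_ p6)/allP[] v v_k.
  by rewrite (perm_mem eqR) map_f.
case/andP; rewrite -(map_inj_uniq (@exps_inj 6)) -/(exps F) => uF gF.
have [k [p [q [p6 q6 eqF]]]] := good_classified uF gF.
exists k; rewrite tnth_mktuple.
(* The common relabelling of [F] and of the representative, through which the two isomorphisms are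
   composed. *)
pose F1 := tuple_of_exps (map (relabel p) (exps F)).
have F1K : exps F1 = map (relabel p) (exps F).
  by apply: tuple_of_expsK; apply: good_relabel.
apply: (@isomorphic_trans _ _ _ F1); last apply: isomorphic_sym.
  by apply/isomorphicP; exists q; rewrite // F1K RK.
by apply/isomorphicP; exists p; rewrite // F1K.
Qed.
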